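(* Let $U$ be a fixed set and let $\mathcal{F}_A$, $\mathcal{G}_B$ be soft sets over $U$. A soft morphism $\alpha:\mathcal{F}_A\to\mathcal{G}_B$ is an epimorphism in the category $\mathbf{Sset(U)}$ if and only if $\alpha$ is surjective (as a function $A\to B$).
   Context: Let $U$ be a fixed universal set. A soft set $\mathcal{F}_A$ over $U$ consists of a set $A$ (the parameter set, an arbitrary set, possibly empty) together with a function $\mathcal{F}:A\to\mathcal{P}(U)$, where $\mathcal{P}(U)$ is the power set of $U$. A soft morphism from a soft set $\mathcal{F}_A$ to a soft set $\mathcal{G}_B$ is a function $\alpha:A\to B$ such that $\mathcal{F}(a)\subseteq(\mathcal{G}\circ\alpha)(a)$ for each $a\in A$; formally it is regarded as the triple $(\mathcal{F}_A,\alpha,\mathcal{G}_B)$. Composition is composition of functions and the identity soft morphism is the identity function. $\mathbf{Sset(U)}$ is the category whose objects are all soft sets over $U$ and whose morphisms are the soft morphisms. A morphism $f:X\to Y$ of a category is an epimorphism if for all pairs of morphisms $h,k:Y\to Z$, $h\circ f=k\circ f$ implies $h=k$. *)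

(* Defs.v *)
From mathcomp Require Import all_boot.
From mathcomp Require Import boolp classical_sets functions.

Set Implicit Arguments.
Unset Strict Implicit.
Unset Printing Implicit Defensive.

Local Open Scope classical_set_scope.

Record category := Category {
  object :> Type;
  hom : object -> object -> Type;
  idm : forall X, hom X X;
  compm : forall X Y Z, hom Y Z -> hom X Y -> hom X Z;
  compm_idl : forall X Y (f : hom X Y), compm (idm Y) f = f;
  compm_idr : forall X Y (f : hom X Y), compm f (idm X) = f;
  compm_assoc : forall W X Y Z (h : hom Y Z) (g : hom X Y) (f : hom W X),
    compm h (compm g f) = compm (compm h g) f
}.

Definition epimorphism (C : category) (X Y : C) (f : hom X Y) : Prop :=
  forall (Z : C) (h k : hom Y Z), compm h f = compm k f -> h = k.

Record soft_set (U : Type) := SoftSet {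
  param : Type;
  soft_map :> param -> set U
}.

(* The source and target of the triple (F_A, alpha, G_B) are recorded in the
   type of the morphism. *)
Record soft_morphism (U : Type) (F G : soft_set U) := SoftMorphism {
  soft_fun :> param F -> param G;
  soft_morphismP : forall a, F a `<=` G (soft_fun a)
}.

Arguments soft_morphismP {U F G} alpha a : rename.

(* Two morphisms with the same source and target are equal exactly when
   their underlying functions are: the inclusion proofs are irrelevant. *)
Lemma soft_morphism_eq (U : Type) (F G : soft_set U)
    (alpha beta : soft_morphism F G) :
  soft_fun alpha = soft_fun beta -> alpha = beta.
Proof.
case: alpha beta => [f Pf] [g Pg] /= fg; case: _ / fg Pg => Pg.
by rewrite (Prop_irrelevance Pf Pg).
Qed.

Definition soft_id (U : Type) (F : soft_set U) : soft_morphism F F :=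
  @SoftMorphism U F F id (fun a => @subset_refl U (F a)).

Definition soft_comp (U : Type) (F G H : soft_set U)
    (beta : soft_morphism G H) (alpha : soft_morphism F G) :
    soft_morphism F H :=
  @SoftMorphism U F H (beta \o alpha)
    (fun a => subset_trans (soft_morphismP alpha a)
                           (soft_morphismP beta (alpha a))).

Lemma soft_comp_idl (U : Type) (F G : soft_set U) (f : soft_morphism F G) :
  soft_comp (soft_id G) f = f.
Proof. exact: soft_morphism_eq. Qed.

Lemma soft_comp_idr (U : Type) (F G : soft_set U) (f : soft_morphism F G) :
  soft_comp f (soft_id F) = f.
Proof. exact: soft_morphism_eq. Qed.

Lemma soft_comp_assoc (U : Type) (E F G H : soft_set U)
    (h : soft_morphism G H) (g : soft_morphism F G) (f : soft_morphism E F) :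
  soft_comp h (soft_comp g f) = soft_comp (soft_comp h g) f.
Proof. exact: soft_morphism_eq. Qed.

Definition Sset (U : Type) : category :=
  @Category (soft_set U) (@soft_morphism U) (@soft_id U) (@soft_comp U)
    (@soft_comp_idl U) (@soft_comp_idr U) (@soft_comp_assoc U).

(* Main.v *)
Require Import Defs.
From mathcomp Require Import all_boot.
From mathcomp Require Import boolp classical_sets functions.

(** If [alpha] is an epimorphism, test it against the soft set with parameter
    set [Prop] all of whose values are the whole universe: every function into
    it is a soft morphism, and the characteristic function of the range of
    [alpha] agrees with the constant [True] after composition with [alpha]. *)

Definition soft_full (U P : Type) : soft_set U :=
  @SoftSet U P (fun=> [set: U]%classic).

Definition to_soft_full (U P : Type) (G : soft_set U) (f : param G -> P) :
    soft_morphism G (soft_full U P) :=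
  @SoftMorphism U G (soft_full U P) f (fun a => @subsetT U (G a)).

Theorem theorem6 (U : Type) (F G : soft_set U) (alpha : soft_morphism F G) :
  @epimorphism (Sset U) F G alpha <->
  set_surj [set: param F]%classic [set: param G]%classic (soft_fun alpha).
Proof.
split=> [epi b _|surj Z h k hk].
  (* A [set] over [param G] is a [Prop]-valued function, so the range serves directly as its own
     characteristic function. *)
  pose h := @to_soft_full U Prop G (range (soft_fun alpha)).
  pose k := @to_soft_full U Prop G (fun=> True).
  have hk : h = k.
    apply: (epi (soft_full U Prop)); apply: soft_morphism_eq.
    apply/funext => a; apply/propext; split=> // _.
    by exists a.
  (* Evaluated at [b], [hk] equates the proposition that [b] lies in the range with [True]. *)
  by have /= -> := congr1 (fun m => soft_fun m b) hk.
apply: soft_morphism_eq; apply/funext => b.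
(* Writing [b] as [alpha a] turns the goal into [hk] evaluated at [a], since composites compute
   pointwise. *)
have [a _ <-] := surj b I.
exact: (congr1 (fun m => soft_fun m a) hk).
Qed.
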